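(* Let $T$ be a bounded linear map on a separable complex Banach space $\mathcal{X}$. Suppose there is a non-trivial $T$-invariant probability measure $\varrho\neq\delta_0$ on $\mathcal{X}$ (equipped with the Borel $\sigma$-algebra). Then the approximate point spectrum $\sigma_{\mathrm{ap}}(T)$ of $T$ satisfies $$\sigma_{\mathrm{ap}}(T)\cap\mathbb{S}^1\neq\emptyset.$$ Furthermore, if $\varrho$ is non-fixing, i.e. if $\varrho(\{x\in\mathcal{X} : Tx=x\})<1$, then $$\sigma_{\mathrm{ap}}(T)\cap(\mathbb{S}^1\setminus\{1\})\neq\emptyset.$$
   Context: $\mathbb{S}^1=\{\lambda\in\mathbb{C} : |\lambda|=1\}$ is the unit circle. A Borel probability measure $\varrho$ on $\mathcal{X}$ is $T$-invariant if $\varrho(T^{-1}(B))=\varrho(B)$ for every Borel set $B\subseteq\mathcal{X}$; $\delta_0$ is the Dirac measure at $0\in\mathcal{X}$. The approximate point spectrum $\sigma_{\mathrm{ap}}(T)$ is the set of $\lambda\in\mathbb{C}$ for which there is a sequence $(x_m)_{m}$ in $\mathcal{X}$ with $\|x_m\|_{\mathcal{X}}=1$ for all $m$ and $\|(T-\lambda)x_m\|_{\mathcal{X}}\to 0$ as $m\to\infty$. *)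

(* Defs.v *)
From HB Require Import structures.
From mathcomp Require Import all_boot all_order all_algebra.
From mathcomp Require Import complex.
From mathcomp Require Import all_classical all_reals all_analysis.

Set Implicit Arguments.
Unset Strict Implicit.
Unset Printing Implicit Defensive.

Import Order.TTheory GRing.Theory Num.Theory.
Import numFieldNormedType.Exports.

Local Open Scope classical_set_scope.
Local Open Scope ring_scope.
Local Open Scope complex_scope.

Definition separable (X : topologicalType) : Prop :=
  exists2 D : set X, countable D & dense D.

Definition borel (X : ptopologicalType) := g_sigma_algebraType (@open X).

(* The norm of a normed module over R[i] is R[i]-valued (with nonnegative real
   values), hence the injection of the bound M. *)
Definition bounded_operator (R : realType) (X : normedModType R[i])
    (T : X -> X) : Prop :=
  exists M : R, forall x : X, `|T x| <= M%:C * `|x|.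

(* [R[i]^o] is R[i] with its usual topology: [R[i]] itself carries no canonical
   topological structure. *)
Definition ap_spectrum (R : realType) (X : normedModType R[i])
    (T : X -> X) : set R[i] :=
  [set lambda | exists x : nat -> X,
    (forall m, `|x m| = 1) /\
    (fun m => `|T (x m) - lambda *: x m| : R[i]^o) @ \oo --> (0 : R[i]^o)].

Definition unit_circle (R : realType) : set R[i] := [set z | `|z| = 1].

Arguments unit_circle : clear implicits.

Definition invariant_measure (R : realType) (X : ptopologicalType)
    (T : X -> X) (rho : probability (borel X) R) : Prop :=
  forall B : set (borel X), measurable B -> rho (T @^-1` B) = rho B.

(* Equality of Borel measures is agreement on Borel sets: a term of type
   [probability] also has unconstrained values on the non-measurable sets, so
   Leibniz equality would be too fine. *)
Definition eq_borel_measure (R : realType) (X : ptopologicalType)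
    (mu nu : {measure set (borel X) -> \bar R}) : Prop :=
  forall B : set (borel X), measurable B -> mu B = nu B.

(* Main.v *)
(** Suppose that [sigma_ap(T)] meets the circle at most at [1], and let [p] be a
point with [T p <> p] all of whose balls have positive measure; such a point
exists if [rho] is non-fixing.  Put [D = T - 1] and let [c] be the measure of a
small ball at [p].

Checkpoints: [|T^n x| <= B] at boundedly many times [n] spread over an interval
of length proportional to [N] forces [|T^n x| <= 2^N B] on the whole interval,
and by invariance this happens with probability close to 1, uniformly in [N].
Localization: [T - l] is bounded below uniformly for [|l| = 1] away from [1], so
a Fourier argument on the circle gives [|D^k T^M x| <= C N 16^-N] for such [x]
and all [k] between [d = N / q] and [N], where [q] is a constant as large as we
please.  By the Newton series [T^n = sum_k 'C(n, k) D^k], the orbit of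
[y = T^M x] is then, on [0, N], exponentially close to a polynomial of degree
[< d].  Such a sequence cannot come close to [p], and one step later to
[T p <> p], more than [d] times: a divided difference at these times has
alternating signs.  So [N c] is at most about [d = N / q], which is absurd for
large [q].

The first assertion follows from the second: if [rho] is carried by the fixed
points and is not the Dirac mass at [0], then [1] is an eigenvalue. *)

Require Import Defs.
From HB Require Import structures.
From mathcomp Require Import all_boot all_order all_algebra.
From mathcomp Require Import complex.
From mathcomp Require Import all_classical all_reals all_analysis.
From mathcomp Require Import measurable_realfun.
From mathcomp Require Import ring lra zify.

Set Implicit Arguments.
Unset Strict Implicit.
Unset Printing Implicit Defensive.

Import Order.TTheory GRing.Theory Num.Theory.
Import numFieldNormedType.Exports.
Import Normc.
Local Open Scope classical_set_scope.
Local Open Scope ring_scope.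
Local Open Scope complex_scope.

(** * Real-valued norm and polynomials in an operator *)

Section RealNorm.
Context {R : realType} {X : normedModType R[i]}.
Implicit Types x y : X.

(** The norm of [X] is [R[i]]-valued; its real part loses nothing and allows estimates in the
    ordered field [R]. *)
Definition rnorm x : R := complex.Re `|x|.

Lemma normE x : `|x| = (rnorm x)%:C.
Proof. by apply/esym/RRe_real/ger0_real. Qed.

Lemma rnorm_ge0 x : 0 <= rnorm x.
Proof. by rewrite -lecR -normE normr_ge0. Qed.

Lemma rnorm0 : rnorm (0 : X) = 0.
Proof. by rewrite /rnorm normr0. Qed.

Lemma rnorm0_eq0 x : rnorm x = 0 -> x = 0.
Proof. by move=> h; apply: normr0_eq0; rewrite normE h. Qed.

Lemma rnorm_gt0 x : (0 < rnorm x) = (x != 0).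
Proof.
rewrite lt_neqAle rnorm_ge0 andbT eq_sym; congr (~~ _).
by apply/eqP/eqP => [/rnorm0_eq0|->]; rewrite ?rnorm0.
Qed.

Lemma rnormN x : rnorm (- x) = rnorm x.
Proof. by rewrite /rnorm normrN. Qed.

Lemma rnormB x y : rnorm (x - y) = rnorm (y - x).
Proof. by rewrite -opprB rnormN. Qed.

Lemma ler_rnormD x y : rnorm (x + y) <= rnorm x + rnorm y.
Proof. rewrite -lecR rmorphD/= -!normE; exact: ler_normD. Qed.

Lemma ler_rnormB x y : rnorm (x - y) <= rnorm x + rnorm y.
Proof. by rewrite -(rnormN y) ler_rnormD. Qed.

Lemma ler_rnorm_sum (I : Type) (r : seq I) (P : pred I) (F : I -> X) :
  rnorm (\sum_(i <- r | P i) F i) <= \sum_(i <- r | P i) rnorm (F i).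
Proof.
elim/big_ind2: _ => [|x a y b xa yb|//]; first by rewrite rnorm0.
exact: le_trans (ler_rnormD _ _) (lerD xa yb).
Qed.

Lemma rnormZ (a : R[i]) x : rnorm (a *: x) = normc a * rnorm x.
Proof.
by apply: complexI; rewrite rmorphM/= -!normE; exact: normrZ.
Qed.

Lemma normc_real (a : R) : normc a%:C = `|a|.
Proof. by rewrite /= expr0n/= addr0 sqrtr_sqr. Qed.

Lemma normc_ge0 (a : R[i]) : 0 <= normc a.
Proof. by rewrite -lecR -[(normc a)%:C]/(`|a|) normr_ge0. Qed.

Lemma rnormZr (a : R) x : rnorm (a%:C *: x) = `|a| * rnorm x.
Proof. by rewrite rnormZ normc_real. Qed.

End RealNorm.

(** * Polynomials in an operator, acting on vectors *)

Section PolyAction.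
Context {R : realType} {X : normedModType R[i]}.
Implicit Types (S : {linear X -> X}) (p q : {poly R[i]}) (x y : X).

Definition pact S p x : X := \sum_(i < size p) p`_i *: iter i S x.

Lemma pactE S p x n : (size p <= n)%N ->
  pact S p x = \sum_(i < n) p`_i *: iter i S x.
Proof.
move=> pn; rewrite /pact (big_ord_widen n (fun i => p`_i *: iter i S x) pn).
rewrite big_mkcond /=; apply: eq_bigr => i _; case: ltnP => // h.
by rewrite nth_default // scale0r.
Qed.

Lemma pactD S p q x : pact S (p + q) x = pact S p x + pact S q x.
Proof.
rewrite (pactE _ _ (size_polyD _ _)).
rewrite (pactE _ _ (leq_maxl _ (size q))).
rewrite (pactE _ _ (leq_maxr (size p) _)) -big_split /=.
by apply: eq_bigr => i _; rewrite coefD scalerDl.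
Qed.

Lemma pactZ S a p x : pact S (a *: p) x = a *: pact S p x.
Proof.
rewrite (pactE _ _ (size_scale_leq a p)) /pact scaler_sumr.
by apply: eq_bigr => i _; rewrite coefZ scalerA.
Qed.

Lemma pactN S p x : pact S (- p) x = - pact S p x.
Proof. by rewrite -scaleN1r pactZ scaleN1r. Qed.

Lemma pact0 S x : pact S 0 x = 0.
Proof. by rewrite /pact size_poly0 big_ord0. Qed.

Lemma pactC S a x : pact S a%:P x = a *: x.
Proof. by rewrite (pactE _ _ (size_polyC_leq1 _)) big_ord1 coefC. Qed.

Lemma pact1 S x : pact S 1 x = x.
Proof. by rewrite pactC scale1r. Qed.

Lemma pactMX S p x : pact S (p * 'X) x = pact S p (S x).
Proof.
have h : (size (p * 'X)%R <= (size p).+1)%N.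
  by have [->|/size_mulX->//] := eqVneq p 0; rewrite mul0r size_poly0.
rewrite (pactE _ _ h) big_ord_recl coefMX /= scale0r add0r.
by apply: eq_bigr => i _; rewrite coefMX /= -iterSr.
Qed.

Lemma pactX S x : pact S 'X x = S x.
Proof. by rewrite -['X]mul1r pactMX pact1. Qed.

Lemma pact_shift S p x : pact S p (S x) = S (pact S p x).
Proof.
rewrite /pact linear_sum; apply: eq_bigr => i _.
by rewrite linearZ -iterSr iterS.
Qed.

Lemma pactM S p q x : pact S (p * q) x = pact S p (pact S q x).
Proof.
elim/poly_ind: p q x => [|p c ih] q x; first by rewrite mul0r !pact0.
rewrite mulrDl !pactD pactC mul_polyC pactZ; congr (_ + _).
by rewrite mulrAC !pactMX -pact_shift ih.
Qed.

Lemma pactXn S n x : pact S 'X^n x = iter n S x.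
Proof.
by elim: n x => [|n ih] x; rewrite ?pact1// exprSr pactMX ih -iterSr.
Qed.

(** The horizon [L] is explicit because applying a polynomial of degree [m] costs [m] steps of
    control. *)
Definition orbit_bound S (L : nat) (A : R) x : Prop :=
  forall n, (n <= L)%N -> rnorm (iter n S x) <= A.

(** Since $p(S)$ commutes with the iterates, $S^n p(S) x$ is a combination of the $S^{n+i} x$, $i
    \le m$, with coefficients of absolute sum at most [b]. *)
Lemma orbit_bound_pact S p (b A : R) (m L : nat) x :
    0 <= A -> (size p <= m.+1)%N -> \sum_(i < m.+1) normc p`_i <= b ->
  orbit_bound S (L + m) A x -> orbit_bound S L (b * A) (pact S p x).
Proof.
move=> A0 pm pb xA n nL.
rewrite -pactXn -pactM mulrC pactM (pactE _ _ pm) pactXn.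
apply: le_trans (ler_rnorm_sum _ _ _) _.
apply: le_trans (ler_wpM2r A0 pb); rewrite mulr_suml; apply: ler_sum => i _.
rewrite rnormZ ler_wpM2l ?normc_ge0//.
by rewrite -iterD; apply: xA; have := ltn_ord i; lia.
Qed.

Lemma orbit_bound_pactX S p (b A : R) (m L s : nat) x :
    0 <= A -> (size p <= m.+1)%N -> \sum_(i < m.+1) normc p`_i <= b ->
  orbit_bound S (L + s * m) A x -> orbit_bound S L (b ^+ s * A) (pact S (p ^+ s) x).
Proof.
move=> A0 pm pb; have b0 : 0 <= b.
  by apply: le_trans pb; apply: sumr_ge0 => i _; exact: normc_ge0.
elim: s L => [|s ih] L xA.
  by rewrite expr0 pact1 mul1r; move: xA; rewrite mul0n addn0.
rewrite !exprS pactM -mulrA; apply: orbit_bound_pact pm pb _ => //.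
  by rewrite mulr_ge0 ?exprn_ge0.
by apply: ih; move: xA; rewrite mulSn addnA.
Qed.

End PolyAction.

(** * Localization near 1 *)

Section UnitCircle.
Context {R : realType}.

Definition expi (t : R) : R[i] := cos t +i* sin t.

Lemma expiD a b : expi (a + b) = expi a * expi b.
Proof.
by apply/eqP; rewrite eq_complex /= cosD sinD addrC eqxx/= [X in X == _]addrC.
Qed.

Lemma normc_expi t : normc (expi t) = 1.
Proof. by rewrite /= cos2Dsin2 sqrtr1. Qed.

Lemma normr_expi t : `|expi t| = 1 :> R[i].
Proof. by rewrite -[LHS]/((normc (expi t))%:C) normc_expi. Qed.

Lemma normcXn (a : R[i]) n : normc (a ^+ n) = normc a ^+ n.
Proof. by elim: n => [|n ih]; rewrite ?normc1// !exprS normcM ih. Qed.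

Lemma expi_neq0 t : expi t != 0.
Proof. by rewrite -normr_eq0 normr_expi oner_eq0. Qed.

Lemma expi0 : expi 0 = 1.
Proof. by rewrite /expi cos0 sin0. Qed.

Lemma expiMn t n : expi (t *+ n) = expi t ^+ n.
Proof. by elim: n => [|n ih]; rewrite ?mulr0n ?expi0// mulrS exprS expiD ih. Qed.

Lemma expi_neq1 t : 0 < t < pi *+ 2 -> expi t != 1.
Proof.
move=> /andP[t0 t2]; rewrite eq_complex negb_and; apply/orP; left => /=.
have -> : t = t / 2 + t / 2 by rewrite -splitr.
have s0 : 0 < sin (t / 2).
  by apply: sin_gt0_pi; rewrite divr_gt0//= ltr_pdivrMr// mulr_natr.
rewrite cosD; have := cos2Dsin2 (t / 2); apply/contraPneq.
set c := cos _; set s := sin _ => h1 h2.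
suff : s * s = 0 by apply/eqP; rewrite mulf_neq0// gt_eqF.
by nra.
Qed.

(** Orthogonality of characters of $Z/K$: the sum is geometric, and its ratio $w^{i-n}$ is a $K$-th
    root of unity that equals $1$ only for $i = n$. *)
Lemma sum_expi_root (K i n : nat) : (i < K)%N -> (n < K)%N ->
  \sum_(j < K) expi (pi *+ 2 / K%:R *+ j) ^+ i * (expi (pi *+ 2 / K%:R *+ j))^-1 ^+ n
    = (if i == n then K%:R else 0) :> R[i].
Proof.
move=> iK nK; set w := expi (pi *+ 2 / K%:R).
have K0 : (0 : R) < K%:R by rewrite ltr0n; lia.
have w0 : w != 0 := expi_neq0 _.
pose r := w ^+ i * w^-1 ^+ n.
rewrite (eq_bigr (fun j : 'I_K => r ^+ j)); last first.
  by move=> j _; rewrite expiMn -/w /r exprMn -!exprVn -!exprM ![(j * _)%N]mulnC.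
case: eqVneq => [in_eq|neq].
  rewrite (eq_bigr (fun=> 1)) ?sumr_const ?card_ord// => j _.
  by rewrite /r in_eq -exprMn divff// !expr1n.
have wK : w ^+ K = 1.
  rewrite /w -expiMn -[X in expi X]mulr_natr divfK ?gt_eqF//.
  by rewrite /expi cos2pi sin2pi.
have rK : r ^+ K = 1.
  by rewrite /r exprMn -!exprM ![(_ * K)%N]mulnC !exprM exprVn wK invr1 !expr1n mulr1.
have w1 l : (0 < l < K)%N -> w ^+ l != 1.
  move=> /andP[l0 lK]; rewrite /w -expiMn expi_neq1// -[_ / _ *+ _]mulr_natr.
  have p2 : 0 < pi *+ 2 :> R by rewrite mulrn_wgt0// pi_gt0.
  apply/andP; split; first by rewrite mulr_gt0 ?divr_gt0// ltr0n.
  by rewrite mulrAC ltr_pdivrMr// ltr_pM2l// ltr_nat.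
have r1 : r != 1.
  rewrite /r exprVn; have wn0 : w ^+ n != 0 by rewrite expf_neq0.
  rewrite -(inj_eq (mulIf wn0)) mul1r mulfVK//.
  case: (ltngtP i n) neq => // h _.
    rewrite -(subnK (ltnW h)) exprD -{1}[w ^+ i]mul1r (inj_eq (mulIf _)) ?expf_neq0//.
    by rewrite eq_sym w1//; lia.
  rewrite -(subnK (ltnW h)) exprD -{2}[w ^+ n]mul1r (inj_eq (mulIf _)) ?expf_neq0//.
  by rewrite w1//; lia.
have /eqP := subrX1 r K; rewrite rK subrr eq_sym mulf_eq0 subr_eq0 (negPf r1) /=.
by move/eqP.
Qed.

End UnitCircle.

(** * Smoothing weights and Fourier averaging over the circle *)

Section Localization.
Context {R : realType} {X : normedModType R[i]}.

Lemma fourier_inversion (K : nat) (Q : {poly R[i]}) (v : nat -> X) :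
    (size Q <= K)%N ->
  \sum_(j < K) Q.[expi (pi *+ 2 / K%:R *+ j)] *:
      (\sum_(n < K) (expi (pi *+ 2 / K%:R *+ j))^-1 ^+ n *: v n)
    = K%:R *: \sum_(n < K) Q`_n *: v n.
Proof.
move=> QK; under eq_bigr => j _.
  rewrite (horner_coef_wide _ QK) scaler_sumr.
  under eq_bigr => n _ do rewrite scalerA mulr_suml scaler_suml.
  over.
rewrite exchange_big scaler_sumr /=; apply: eq_bigr => n _.
rewrite exchange_big /= (bigD1 n)//= [X in _ + X]big1 ?addr0 => [|i ni].
  rewrite -scaler_suml; under eq_bigr => j _ do rewrite -mulrA.
  by rewrite -mulr_sumr sum_expi_root// eqxx mulrC scalerA.
rewrite -scaler_suml; under eq_bigr => j _ do rewrite -mulrA.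
by rewrite -mulr_sumr sum_expi_root// ifN// mulr0 scale0r.
Qed.

Definition geom m : {poly R[i]} := \poly_(i < m) 1.

Lemma geomE m : (1 - 'X) * geom m = 1 - 'X^m.
Proof.
rewrite -[1 - 'X]opprB -[1 - 'X^m]opprB subrX1 mulNr /geom poly_def.
by congr (- (_ * _)); apply: eq_bigr => i _; rewrite scale1r.
Qed.

Lemma size_geom m : (size (geom m) <= m.+1)%N.
Proof. exact: leq_trans (size_poly _ _) (leqnSn _). Qed.

Lemma sum_geom m : \sum_(i < m.+1) normc (geom m)`_i <= m%:R :> R.
Proof.
rewrite big_ord_recr/= coef_poly ltnn normc0 addr0.
rewrite (eq_bigr (fun=> 1)) ?sumr_const ?card_ord// => i _.
by rewrite coef_poly ltn_ord normc1.
Qed.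

(** Convolution of [s] boxes of length [m] with a box of length [W], hence constant in the middle.
    The factor $(1-X)^s$ turns it into $(1-X^m)^s$ [geom W], whose coefficients are far smaller than
    $m^s$ when [m] is large. *)
Definition plateau m s W : {poly R[i]} := geom m ^+ s * geom W.

Lemma size_plateau m s W : (size (plateau m s W) <= (s * m + W).+1)%N.
Proof.
apply: leq_trans (size_polyMleq _ _) _.
have h1 := size_poly_exp_leq (geom m) s; have h2 := size_geom W.
have h3 : ((size (geom m)).-1 * s <= s * m)%N.
  rewrite mulnC leq_mul2l; apply/orP; right.
  by have := size_geom m; case: (size _).
lia.
Qed.

(** In this range the convolution sees every coefficient of [geom m ^+ s] with weight $1$, so it
    returns the value of that polynomial at $1$. *)
Lemma coef_plateau m s W n : (s * m <= n)%N -> (n < W)%N ->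
  (plateau m s W)`_n = m%:R ^+ s.
Proof.
move=> sn nW; rewrite /plateau coefM.
have szp : (size (geom m ^+ s) <= n.+1)%N.
  apply: leq_trans (size_poly_exp_leq _ _) _; rewrite ltnS mulnC.
  apply: leq_trans sn; rewrite leq_mul2l; apply/orP; right.
  by have := size_geom m; case: (size _).
rewrite (eq_bigr (fun i : 'I_n.+1 => (geom m ^+ s)`_i * 1 ^+ i)); last first.
  by move=> i _; rewrite [in geom W]/geom coef_poly (leq_ltn_trans (leq_subr _ _) nW) expr1n.
rewrite -(horner_coef_wide _ szp) horner_exp; congr (_ ^+ _).
rewrite /geom horner_poly (eq_bigr (fun=> 1)) ?sumr_const ?card_ord// => i _.
by rewrite expr1n mulr1.
Qed.

Lemma plateau_bound (S : {linear X -> X}) (A : R) m s W (x : X) :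
    0 <= A -> orbit_bound S (s * m + W) A x ->
  rnorm (pact S (plateau m s W) x) <= m%:R ^+ s * (W%:R * A).
Proof.
move=> A0 xA; rewrite pactM.
have := @orbit_bound_pactX _ _ S (geom m) m%:R (W%:R * A) m 0 s (pact S (geom W) x).
move=> /(_ _ (size_geom _) (sum_geom _) _ 0%N (leqnn _)); apply.
  by rewrite mulr_ge0.
by rewrite add0n; apply: orbit_bound_pact (size_geom _) (sum_geom _) _.
Qed.

(** The lower bound, used [s] times, passes to $(1-S)^s z$, where the boxes collapse to $(1-S^m)^s$.
    For positive [k] and [m] this improves [plateau_bound] by the factor $(2/(km))^s$. *)
Lemma plateau_resolvent_bound (S : {linear X -> X}) (A k : R) m s W (x : X) :
    0 <= A -> 0 <= k -> (forall y, k * rnorm y <= rnorm (y - S y)) ->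
    orbit_bound S (s * m + W) A x ->
  k ^+ s * rnorm (pact S (plateau m s W) x) <= 2 ^+ s * (W%:R * A).
Proof.
move=> A0 k0 Sk xA; set z := pact S _ x.
apply: (@le_trans _ _ (rnorm (pact S ((1 - 'X) ^+ s) z))).
  elim: s {xA} z => [|s ih] z; first by rewrite !expr0 pact1 mul1r.
  rewrite !exprSr -mulrA pactM; apply: le_trans (ih _).
  rewrite ler_wpM2l ?exprn_ge0//; apply: le_trans (Sk _) _.
  by rewrite pactD pactN pact1 pactX.
rewrite /z -pactM /plateau [_ * (geom m ^+ s * _)]mulrA -exprMn geomE pactM.
have h : \sum_(i < m.+1) normc (1 - 'X^m : {poly R[i]})`_i <= 2.
  apply: (@le_trans _ _ (\sum_(i < m.+1)
      (normc (1 : {poly R[i]})`_i + normc ('X^m : {poly R[i]})`_i))).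
    apply: ler_sum => i _; rewrite coefB -(normcN 'X^m`_i); exact: le_normcD.
  rewrite big_split/= big_ord_recl coef1 normc1 big1 => [|i _]; last by rewrite coef1 normc0.
  rewrite big_ord_recr/= coefXn eqxx normc1 big1 ?add0r ?addr0// => i _.
  by rewrite coefXn ltn_eqF// normc0.
have := @orbit_bound_pactX _ _ S (1 - 'X^m) 2 (W%:R * A) m 0 s (pact S (geom W) x).
move=> /(_ _ _ h _ 0%N (leqnn _)); apply.
- by rewrite mulr_ge0.
- by apply: leq_trans (size_polyD _ _) _; rewrite geq_max size_polyN size_polyXn size_poly1 leqnn andbT.
by rewrite add0n; apply: orbit_bound_pact (size_geom _) (sum_geom _) _.
Qed.

(* The circle average of [(l - 1)^k l^M z_l], where [z_l] is the orbit of [x]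
   under [l^-1 T] smoothed by the plateau weights, is [m^s (T - 1)^k T^M x].
   Near [l = 1] the factor [(l - 1)^k] is small; elsewhere the [s]-fold
   resolvent bound makes [z_l] small. *)
Lemma localization (T : {linear X -> X}) (d e A : R) m s W M k (x : X) :
    0 < d -> (0 < m)%N -> 0 <= A -> 0 <= e ->
    orbit_bound T (s * m + W) A x ->
    (forall t, 0 <= t <= pi *+ 2 -> normc (expi t - 1) <= e \/
      forall y, d * rnorm y <= rnorm (T y - expi t *: y)) ->
    (s * m <= M)%N -> (M + k < W)%N ->
  rnorm (pact T (('X - 1) ^+ k) (iter M T x)) <=
    W%:R * A * (e ^+ k + 2 ^+ k * (2 / (d * m%:R)) ^+ s).
Proof.
move=> d0 m0 A0 e0 xA He sM MW.
set C := (X in _ <= X); set y := pact _ _ _.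
pose Q : {poly R[i]} := ('X - 1) ^+ k * 'X^M.
have yE : y = pact T Q x by rewrite /Q pactM pactXn.
have m0' : (0 : R) < m%:R by rewrite ltr0n.
have szQ : (size Q <= (M + k).+1)%N.
  rewrite /Q -['X - 1]/('X - 1%:P).
  apply: leq_trans (size_polyMleq _ _) _.
  by rewrite size_exp_XsubC size_polyXn; lia.
(* More nodes than the degree bound of the plateau polynomial, so sampling loses no coefficient. *)
pose K := (s * m + W).+1.
have QK : (size Q <= K)%N by rewrite /K; lia.
pose v n := (plateau m s W)`_n *: iter n T x.
(* The coefficients of [Q] live in degrees [M] to [M + k], where the plateau weight is constant. *)
have sumQ : \sum_(n < K) Q`_n *: v n = (m%:R ^+ s) *: y.
  rewrite yE (pactE _ _ QK) scaler_sumr; apply: eq_bigr => n _.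
  rewrite /v !scalerA; have [nM|Mn] := ltnP n M.
    by rewrite /Q coefMXn nM mul0r mulr0.
  have [nW|Wn] := ltnP n W.
    by rewrite coef_plateau ?(leq_trans sM)// mulrC.
  by rewrite (nth_default _ (leq_trans szQ _)) ?mul0r ?mulr0//; lia.
have zE t : exists2 z, rnorm z <= m%:R ^+ s * (W%:R * A) /\
    ((forall y, d * rnorm y <= rnorm (T y - expi t *: y)) ->
      d ^+ s * rnorm z <= 2 ^+ s * (W%:R * A)) &
    \sum_(n < K) (expi t)^-1 ^+ n *: v n = z.
  (* The unimodular twist keeps the norms along orbits and turns $T - l$ into a multiple of $S -
     1$. *)
  pose S : {linear X -> X} := (expi t)^-1 \*: T.
  have itS n : iter n S x = (expi t)^-1 ^+ n *: iter n T x.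
    elim: n => [|n ih]; first by rewrite expr0 scale1r.
    by rewrite !iterS ih linearZ /= scalerA exprSr.
  have nS n u : rnorm ((expi t)^-1 ^+ n *: u) = rnorm (u : X).
    by rewrite rnormZ normcXn normcV normc_expi invr1 expr1n mul1r.
  have xS : orbit_bound S (s * m + W) A x.
    by move=> n nL; rewrite itS nS; exact: xA.
  exists (pact S (plateau m s W) x).
    split; first exact: plateau_bound.
    move=> Ht; apply: plateau_resolvent_bound => //; first exact: ltW.
    move=> u; apply: le_trans (Ht u) _.
    rewrite -(nS 1%N (T u - _)) expr1 scalerBr scalerA mulVf ?expi_neq0// scale1r.
    by rewrite rnormB.
  rewrite (pactE _ _ (size_plateau _ _ _)); apply: eq_bigr => n _.
  by rewrite itS /v !scalerA mulrC.
have bnd j : (j < K)%N -> rnorm (Q.[expi (pi *+ 2 / K%:R *+ j)] *: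
      (\sum_(n < K) (expi (pi *+ 2 / K%:R *+ j))^-1 ^+ n *: v n)) <= m%:R ^+ s * C.
  move=> jK; set t := _ *+ j.
  have t2 : 0 <= t <= pi *+ 2.
    have p2 : 0 < pi *+ 2 :> R by rewrite mulrn_wgt0// pi_gt0.
    rewrite /t -[_ / _ *+ _]mulr_natr; apply/andP; split.
      by rewrite mulr_ge0// divr_ge0// ltW.
    by rewrite mulrAC ler_pdivrMr ?ltr0n// ler_pM2l// ler_nat ltnW.
  have [z [z1 z2] ->] := zE t.
  rewrite rnormZ /Q hornerM horner_exp hornerXn hornerD hornerN hornerX -polyC1 hornerC.
  rewrite normcM !normcXn normc_expi expr1n mulr1.
  have WA : 0 <= W%:R * A by rewrite mulr_ge0.
  have ms : 0 < m%:R ^+ s :> R by rewrite exprn_gt0.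
  have r0 : 0 <= 2 / (d * m%:R) by rewrite divr_ge0// mulr_ge0// ltW.
  (* Each case yields one summand of [C]; the other is nonnegative. *)
  rewrite /C mulrDr mulrDr; have [near|far] := He t t2.
    apply: ler_wpDr.
      by rewrite !mulr_ge0// ?exprn_ge0// ltW.
    rewrite [W%:R * A * _]mulrC mulrCA ler_pM ?exprn_ge0 ?normc_ge0 ?rnorm_ge0//.
    by rewrite lerXn2r// nnegrE normc_ge0.
  apply: ler_wpDl; first by rewrite !mulr_ge0// ?exprn_ge0// ltW.
  have e2 : normc (expi t - 1) <= 2.
    by apply: le_trans (le_normcD _ _) _; rewrite normcN normc1 normc_expi.
  have -> : m%:R ^+ s * (W%:R * A * (2 ^+ k * (2 / (d * m%:R)) ^+ s)) =
      2 ^+ k * (2 ^+ s * (W%:R * A) / d ^+ s).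
    rewrite expr_div_n exprMn; field.
    by rewrite !expf_neq0// gt_eqF.
  rewrite ler_pM ?exprn_ge0 ?normc_ge0 ?rnorm_ge0//.
    by rewrite lerXn2r// ?nnegrE ?normc_ge0.
  by rewrite ler_pdivlMr ?exprn_gt0// mulrC z2.
have := fourier_inversion v QK; rewrite sumQ => /(congr1 rnorm).
rewrite scalerA rnormZ normcM normcXn => fE.
have normcn n : normc (n%:R : R[i]) = n%:R.
  by rewrite -[n%:R](rmorph_nat (real_complex R)) normc_real normr_nat.
rewrite !normcn in fE.
have K0 : 0 < K%:R * m%:R ^+ s :> R by rewrite mulr_gt0 ?exprn_gt0// ltr0n.
rewrite -(ler_pM2l K0) -fE; apply: le_trans (ler_rnorm_sum _ _ _) _.
apply: (@le_trans _ _ (\sum_(j < K) m%:R ^+ s * C)).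
  by apply: ler_sum => j _; exact: bnd.
by rewrite sumr_const card_ord -[_ *+ K]mulr_natl mulrA.
Qed.

End Localization.

(** * Divided differences and visits to a ball *)

Section DividedDifferences.
Context {R : realType}.

(** The weights are $1/|\prod_{j \ne i}(x_i - x_j)|$. The signed sum is, up to sign, the coefficient
    of $X^n$ in the Lagrange interpolant of [Q], which is [Q] itself. *)
Lemma divided_difference (n : nat) (x : nat -> R) :
    (forall i j, (i < j <= n)%N -> x i < x j) ->
  exists w : nat -> R, (forall i, (i <= n)%N -> 0 < w i) /\
    forall Q : {poly R}, (size Q <= n)%N ->
      \sum_(i < n.+1) (-1) ^+ i * w i * Q.[x i] = 0.
Proof.
move=> xmono.
have xneq (i j : 'I_n.+1) : i != j -> x i != x j.
  move=> ij; case: (ltngtP i j) => h; last by rewrite (ord_inj h) eqxx in ij.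
    by rewrite lt_eqF// xmono// h -ltnS ltn_ord.
  by rewrite gt_eqF// xmono// h -ltnS ltn_ord.
pose p (i : 'I_n.+1) : {poly R} := \prod_(j < n.+1 | j != i) ('X - (x j)%:P).
pose c i := (p i).[x i].
have pE i j : j != i -> (p i).[x j] = 0.
  by move=> ji; rewrite /p (bigD1 j)//= hornerM hornerXsubC subrr mul0r.
have cE i : c i = \prod_(j < n.+1 | j != i) (x i - x j).
  by rewrite /c /p horner_prod; apply: eq_bigr => j _; rewrite hornerXsubC.
(* The nodes increase, so exactly the [n - i] factors with $j > i$ are negative. *)
have c_sg i : Num.sg (c i) = (-1) ^+ (n - i).
  rewrite cE; have -> : Num.sg (\prod_(j < n.+1 | j != i) (x i - x j)) =
      \prod_(j < n.+1 | j != i) Num.sg (x i - x j).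
    exact: (big_morph _ (@sgrM R) (@sgr1 R)).
  rewrite big_mkcond /= (eq_bigr (fun j : 'I_n.+1 => if (j <= i)%N then 1 else -1)).
    rewrite -(big_mkord xpredT (fun j => if (j <= i)%N then 1 else -1)).
    rewrite (big_cat_nat (n := i.+1))//=.
    rewrite big_nat_cond big1 ?mul1r => [|j /andP[/andP[_ ji] _]].
      rewrite big_nat_cond (eq_bigr (fun=> -1)) -?big_nat_cond ?prodr_const_nat ?subSS//.
      by move=> j /andP[/andP[ij _] _]; rewrite leqNgt ij.
    by rewrite -ltnS ji.
  move=> j _; case: (ltngtP i j) => h.
  - by rewrite -val_eqE /= gtn_eqF//= ltr0_sg// subr_lt0 xmono// h -ltnS ltn_ord.
  - by rewrite -val_eqE /= ltn_eqF//= gtr0_sg// subr_gt0 xmono// h -ltnS ltn_ord.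
  - by rewrite (ord_inj h) eqxx.
have c0 i : c i != 0 by rewrite -sgr_eq0 c_sg expf_neq0// oppr_eq0 oner_eq0.
exists (fun i => `|c (inord i)|^-1); split=> [i _|Q szQ].
  by rewrite invr_gt0 normr_gt0.
have pmon i : p i \is monic by apply: monic_prod_XsubC.
have szp i : size (p i) = n.+1.
  rewrite /p -big_filter size_prod_XsubC size_filter -sum1_count.
  by rewrite (sum1_card (predC1 i)) cardC1 card_ord.
pose L := \sum_(i < n.+1) (Q.[x i] / c i) *: p i.
have QL : Q = L.
  apply/eqP; rewrite -subr_eq0; apply/eqP.
  apply: (@roots_geq_poly_eq0 _ _ [seq x (i : 'I_n.+1) | i <- enum 'I_n.+1]).
  - apply/allP => _ /mapP[i _ ->]; rewrite rootE hornerD hornerN subr_eq0; apply/eqP.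
    rewrite /L horner_sum (bigD1 i)//= big1 ?addr0.
      by rewrite hornerZ -/(c i) divfK.
    by move=> j ji; rewrite hornerZ pE ?mulr0// eq_sym.
  - rewrite map_inj_uniq ?enum_uniq// => i j xij; apply/eqP.
    by case: eqVneq => // /xneq; rewrite xij eqxx.
  - rewrite size_map size_enum_ord; apply: leq_trans (size_polyD _ _) _.
    rewrite geq_max size_polyN (leq_trans szQ)//= /L.
    apply: leq_trans (size_sum _ _ _) _; apply/bigmax_leqP => i _.
    by apply: leq_trans (size_scale_leq _ _) _; rewrite szp.
have : Q`_n = 0 by rewrite nth_default.
rewrite [in Q`_n]QL /L coef_sum => L0.
transitivity ((-1) ^+ n * \sum_(i < n.+1) (Q.[x i] / c i *: p i)`_n).
  rewrite mulr_sumr; apply: eq_bigr => i _; rewrite coefZ.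
  have -> : (p i)`_n = 1 by have /monicP := pmon i; rewrite lead_coefE szp.
  rewrite inord_val mulr1 [Q.[_] / _]mulrC mulrA; congr (_ * _).
  have in_ : (i <= n)%N by rewrite -ltnS.
  have -> : (-1) ^+ i = (-1) ^+ n * (-1) ^+ (n - i) :> R.
    by rewrite -[in (-1) ^+ n](subnK in_) exprD mulrC signrMK.
  rewrite -mulrA; congr (_ * _); rewrite -c_sg.
  by rewrite [in RHS](numEsg (c i)) invfM invr_sg.
by rewrite L0 mulr0.
Qed.

(** This makes the low terms of a Newton series invisible to divided differences. Induction on
    $(k+1)\binom{n}{k+1} = (n-k)\binom{n}{k}$. *)
Lemma binomial_poly (k : nat) :
  exists2 B : {poly R}, (size B <= k.+1)%N & forall n, B.[n%:R] = 'C(n, k)%:R.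
Proof.
elim: k => [|k [B szB BE]].
  by exists 1 => [|n]; rewrite ?size_poly1// hornerC bin0.
exists ((k.+1%:R)^-1 *: (B * ('X - k%:R%:P))) => [|n].
  apply: leq_trans (size_scale_leq _ _) _; apply: leq_trans (size_polyMleq _ _) _.
  by rewrite size_XsubC addn2.
rewrite hornerZ hornerM hornerXsubC BE.
have k0 : (k.+1%:R : R) != 0 by rewrite pnatr_eq0.
apply: (mulfI k0); rewrite mulrA divff// mul1r -natrM mul_bin_left natrM mulrC.
have [kn|nk] := leqP k n; first by rewrite natrB.
by rewrite bin_small// !mulr0.
Qed.

End DividedDifferences.

Section FewVisits.
Context {R : realType} {X : normedModType R[i]}.

(** Expand $T = 1 + (T-1)$; the binomials with $k > n$ vanish, so one range of summation serves all
    $n \le N$. *)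
Lemma iter_binomial (T : {linear X -> X}) (N n : nat) (y : X) : (n <= N)%N ->
  iter n T y = \sum_(k < N.+1) ('C(n, k)%:R : R)%:C *: pact T (('X - 1) ^+ k) y.
Proof.
move=> nN; rewrite -pactXn -{1}['X](subrK 1) addrC exprDn.
rewrite (big_ord_widen_cond N.+1 xpredT
  (fun k => 1 ^+ (n - k) * ('X - 1 : {poly R[i]}) ^+ k *+ 'C(n, k))) ?ltnS//.
rewrite big_mkcond /= (big_morph (fun q => pact T q y) (fun q1 q2 => pactD T q1 q2 y) (pact0 T y)).
apply: eq_bigr => k _; rewrite expr1n mul1r; case: ifPn => [kn|].
  by rewrite -scaler_nat pactZ rmorph_nat.
by rewrite -leqNgt => kn; rewrite bin_small// rmorph0 scale0r pact0.
Qed.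

Lemma sum_bin_le (N n : nat) : (n <= N)%N -> (\sum_(k < N.+1) 'C(n, k) <= 2 ^ N)%N.
Proof.
move=> nN; apply: leq_trans (leq_pexp2l _ nN) => //.
rewrite -[2%N]/(1 + 1)%N expnDn (big_ord_widen N.+1 (fun k => 'C(n, k) * (1 ^ (n - k) * 1 ^ k)))%N ?ltnS//.
rewrite [leqRHS]big_mkcond /=; apply: leq_sum => k _; rewrite !exp1n !muln1.
by case: ltnP => // nk; rewrite bin_small.
Qed.

(* Each visit to the ball gives two consecutive nodes, where the orbit is close
   to [p] and to [T p].  The weights of a divided difference alternate in sign,
   so it maps the orbit to nearly a multiple of [T p - p]; but it kills the
   terms of degree [< d] of the Newton series. *)
Lemma displacement_le_of_visits (T : {linear X -> X}) (t r e : R) (N d : nat) (p y : X) :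
    0 <= t -> 0 <= r -> 0 <= e -> (forall u, rnorm (T u) <= t * rnorm u) ->
    (0 < d)%N ->
    (forall k, (d <= k <= N)%N -> rnorm (pact T (('X - 1) ^+ k) y) <= e) ->
    (d <= count (fun j => rnorm (iter j T y - p) < r)%R (iota 0 N))%N ->
  rnorm (T p - p) <= (1 + t) * r + 2 * (2 ^+ N * e).
Proof.
move=> t0 r0 e0 Tt d0 small visits; rewrite leNgt; apply/negP => Dp.
pose near j := rnorm (iter j T y - p) < r.
pose s := [seq j <- iota 0 N | near j].
have ss : sorted ltn s by apply: sorted_filter; [exact: ltn_trans | exact: iota_ltn_sorted].
have sized : (d <= size s)%N by rewrite size_filter.
have nears i : (i < d)%N -> near (nth 0%N s i) /\ (nth 0%N s i < N)%N.
  move=> id_; have : nth 0%N s i \in s by apply: mem_nth; apply: leq_trans sized.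
  by rewrite mem_filter mem_iota add0n => /andP[-> /andP[_ ->]].
have next j : near j -> rnorm (iter j.+1 T y - T p) <= t * r.
  move=> nj; rewrite iterS -linearB; apply: le_trans (Tt _) _.
  by rewrite ler_wpM2l// ltW.
(* Consecutive visits would force $|Tp - p| \le (1+t)r$, against [Dp]. Hence the pairs of nodes
   chosen below are disjoint. *)
have nonadj j : near j -> near j.+1 -> False.
  move=> nj nj1; have := next _ nj; have := nj1; rewrite /near => h1 h2.
  have := ler_rnormD (T p - iter j.+1 T y) (iter j.+1 T y - p).
  rewrite addrA subrK [rnorm (T p - iter _ _ _)]rnormB => h3.
  have : 0 <= 2 * (2 ^+ N * e) by rewrite !mulr_ge0// exprn_ge0.
  by lra.
(* Even nodes are visits, near [p]; each odd node is the next time, near [T p]. The first [d] visits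
   give [2d] nodes, so the difference kills all degrees below $2d-1$, in particular those below
   [d]. *)
pose x (i : nat) : nat := (nth 0 s i./2 + odd i)%N.
pose n := (d.*2).-1.
have nd : n.+1 = d.*2 by rewrite /n prednK// double_gt0.
have half_lt i : (i <= n)%N -> (i./2 < d)%N.
  by rewrite -ltnS nd => h; rewrite -(ltn_double); apply: leq_ltn_trans h; rewrite -{2}(odd_double_half i) leq_addl.
have xmono i j : (i < j <= n)%N -> (x i < x j)%N.
  move=> /andP[ij jn]; have jd := half_lt _ jn.
  have : (i./2 <= j./2)%N by apply: half_leq; exact: ltnW.
  rewrite leq_eqVlt => /orP[/eqP ij2|ij2].
    rewrite /x ij2 ltn_add2l; move: ij.
    rewrite -{1}(odd_double_half i) -{1}(odd_double_half j) ij2 ltn_add2r.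
    by [].
  have := sorted_ltn_nth ltn_trans 0%N ss.
  move=> /(_ i./2 j./2); rewrite !inE => /(_ _ _ ij2) h.
  have {}h : (nth 0 s i./2 < nth 0 s j./2)%N.
    by apply: h; apply: leq_trans sized => //; exact: ltn_trans ij2 _.
  have [ni _] := nears _ (ltn_trans ij2 jd); have [nj _] := nears _ jd.
  have : nth 0%N s j./2 != (nth 0%N s i./2).+1.
    by apply/eqP => E; apply: (nonadj _ ni); rewrite -E.
  move=> nE; apply: leq_trans (leq_addr _ _); rewrite -addn1 in nE.
  apply: (@leq_ltn_trans (nth 0 s i./2 + 1)); first by rewrite leq_add2l leq_b1.
  by rewrite ltn_neqAle eq_sym nE addn1.
have xN i : (i <= n)%N -> (x i <= N)%N.
  by move=> /half_lt /nears[_]; rewrite /x; case: (odd i); lia.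
have [|w [w0 wQ]] := @divided_difference R n (fun i => (x i)%:R).
  by move=> i j ij; rewrite ltr_nat xmono.
pose sw i : R := (-1) ^+ i * w i.
have sw_norm i : (i <= n)%N -> `|sw i| = w i.
  by move=> h; rewrite /sw normrM normr_sign mul1r gtr0_norm// w0.
have newton : rnorm (\sum_(i < n.+1) (sw i)%:C *: iter (x i) T y) <=
    \sum_(i < n.+1) w i * (2 ^+ N * e).
  under eq_bigr => i _ do rewrite (iter_binomial T y (xN i (ltn_ord i))) scaler_sumr.
  rewrite exchange_big /=.
  apply: le_trans (ler_rnorm_sum _ _ _) _.
  apply: (@le_trans _ _ (\sum_(k < N.+1) \sum_(i < n.+1) w i * 'C(x i, k)%:R * e)).
    apply: ler_sum => k _; have [kd|dk] := ltnP k d.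
      have [B szB BE] := @binomial_poly R k.
      rewrite (_ : \sum_(i < n.+1) _ = 0) ?rnorm0.
        by apply: sumr_ge0 => i _; rewrite !mulr_ge0// ltW// w0// leq_ord.
      rewrite (eq_bigr (fun i : 'I_n.+1 => (sw i * B.[(x i)%:R])%:C *:
          pact T (('X - 1) ^+ k) y)) => [|i _].
        rewrite -scaler_suml -rmorph_sum/= wQ ?rmorph0 ?scale0r//.
        by apply: leq_trans szB _; rewrite /n -addnn; lia.
      by rewrite scalerA -rmorphM BE.
    apply: le_trans (ler_rnorm_sum _ _ _) _; apply: ler_sum => i _.
    rewrite scalerA rnormZ normcM !normc_real normr_nat (sw_norm _ (leq_ord i)).
    apply: ler_wpM2l; first by rewrite mulr_ge0// ltW// w0// leq_ord.
    by apply: small; rewrite dk leq_ord.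
  rewrite exchange_big /=; apply: ler_sum => i _.
  rewrite -mulr_suml -mulr_sumr -mulrA ler_wpM2l ?(ltW (w0 _ (leq_ord i)))//.
  by rewrite ler_wpM2r// -natr_sum -natrX ler_nat sum_bin_le// xN// leq_ord.
pose c i := if odd i then T p else p.
pose S := \sum_(i < n.+1 | odd i) w i.
have S0 : 0 < S.
  have n1 : (1 < n.+1)%N by rewrite nd -[1%N]/(0.*2.+1) ltn_Sdouble.
  rewrite /S (bigD1 (Ordinal n1))//= ltr_wpDr ?w0//.
  by apply: sumr_ge0 => i _; rewrite ltW// w0// leq_ord.
(* Applied to the constant $1$, the divided difference shows that even and odd weights have equal
   sums. *)
have sum_sw : \sum_(i < n.+1) sw i = 0.
  have n_gt0 : (0 < n)%N by rewrite -ltnS nd -[1%N]/(0.*2.+1) ltn_Sdouble.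
  rewrite -[RHS](wQ 1) ?size_poly1//.
  by apply: eq_bigr => i _; rewrite hornerC mulr1.
have Seven : \sum_(i < n.+1 | ~~ odd i) w i = S.
  move: sum_sw; rewrite (bigID (fun i : 'I__ => odd i))/=.
  rewrite (eq_bigr (fun i : 'I_n.+1 => - w i)) => [|i oi]; last first.
    by rewrite /sw -signr_odd oi expr1 mulN1r.
  rewrite [X in _ + X](eq_bigr (fun i : 'I_n.+1 => w i)) => [|i oi]; last first.
    by rewrite /sw -signr_odd (negPf oi) expr0 mul1r.
  by rewrite sumrN addrC => /eqP; rewrite subr_eq0 => /eqP.
have cE : rnorm (\sum_(i < n.+1) (sw i)%:C *: c i) = S * rnorm (T p - p).
  have -> : \sum_(i < n.+1) (sw i)%:C *: c i = - (S%:C *: (T p - p)).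
    rewrite (bigID (fun i : 'I__ => odd i))/=.
    rewrite (eq_bigr (fun i : 'I_n.+1 => (- w i)%:C *: T p)) => [|i oi]; last first.
      by rewrite /sw /c -signr_odd oi expr1 mulN1r.
    rewrite [X in _ + X](eq_bigr (fun i : 'I_n.+1 => (w i)%:C *: p)) => [|i oi]; last first.
      by rewrite /sw /c -signr_odd (negPf oi) expr0 mul1r.
    rewrite -!scaler_suml -!rmorph_sum/= Seven sumrN -/S.
    by rewrite rmorphN scaleNr scalerBr opprB addrC.
  by rewrite rnormN rnormZr gtr0_norm.
have close i : (i <= n)%N -> rnorm (c i - iter (x i) T y) <= if odd i then t * r else r.
  move=> /half_lt /nears[ni _]; rewrite rnormB /c /x; case: (odd i).
    by rewrite addn1 next.
  by rewrite addn0 ltW.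
have sumw : \sum_(i < n.+1) w i = 2 * S.
  by rewrite (bigID (fun i : 'I__ => odd i))/= Seven -/S; ring.
have main : S * rnorm (T p - p) <= S * (t * r) + S * r + 2 * S * (2 ^+ N * e).
  rewrite -cE.
  have -> : \sum_(i < n.+1) (sw i)%:C *: c i =
     \sum_(i < n.+1) (sw i)%:C *: (c i - iter (x i) T y) +
     \sum_(i < n.+1) (sw i)%:C *: iter (x i) T y.
    by rewrite -big_split; apply: eq_bigr => i _; rewrite /= -scalerDr subrK.
  apply: le_trans (ler_rnormD _ _) _; apply: lerD; last first.
    by apply: le_trans newton _; rewrite -mulr_suml sumw.
  apply: le_trans (ler_rnorm_sum _ _ _) _.
  rewrite -{2}Seven /S !mulr_suml.
  rewrite (bigID (fun i : 'I__ => odd i))/=; apply: lerD; apply: ler_sum => i oi.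
    rewrite rnormZr (sw_norm _ (leq_ord i)) ler_wpM2l ?(ltW (w0 _ (leq_ord i)))//.
    by have := close i (leq_ord i); rewrite oi.
  rewrite rnormZr (sw_norm _ (leq_ord i)) ler_wpM2l ?(ltW (w0 _ (leq_ord i)))//.
  by have := close i (leq_ord i); rewrite (negPf oi).
move: Dp; rewrite -(ltr_pM2l S0) ltNge => /negP; apply.
by apply: le_trans main _; rewrite le_eqVlt; apply/orP; left; apply/eqP; ring.
Qed.

End FewVisits.

(** * Uniform lower bounds off the spectrum *)

Section ApproximateSpectrum.
Context {R : realType} {X : normedModType R[i]}.

(** If each $1/(m+1)$ fails as a lower bound, the normalized witnesses are approximate
    eigenvectors. *)
Lemma not_ap_spectrum_bounded_below (T : {linear X -> X}) (l : R[i]) :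
    ~ ap_spectrum T l ->
  exists2 d : R, 0 < d & forall y, d * rnorm y <= rnorm (T y - l *: y).
Proof.
move=> nl; apply: contrapT => h; apply: nl.
have /choice[u uP] : forall m : nat, exists y : X,
    rnorm (T y - l *: y) < m.+1%:R^-1 * rnorm y.
  move=> m; apply: contrapT => hm; apply: h; exists m.+1%:R^-1; first by rewrite invr_gt0.
  by move=> y; rewrite leNgt; apply/negP => hy; apply: hm; exists y.
have u0 m : 0 < rnorm (u m).
  have m0 : 0 < m.+1%:R^-1 :> R by rewrite invr_gt0.
  by have := le_lt_trans (rnorm_ge0 _) (uP m); rewrite pmulr_rgt0.
exists (fun m => ((rnorm (u m))^-1)%:C *: u m); split.
  by move=> m; rewrite normE rnormZr ger0_norm ?invr_ge0 ?ltW// mulVf// gt_eqF.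
apply/cvgr0Pnorm_lt => e e0.
have eE : e = (complex.Re e)%:C by rewrite RRe_real// gtr0_real.
have re0 : 0 < complex.Re e by rewrite -ltcR -eE.
near=> m.
rewrite normr_id linearZ /= scalerA [_ * _%:C]mulrC -scalerA -scalerBr normE eE ltcR rnormZr.
rewrite ger0_norm ?invr_ge0 ?ltW// mulrC ltr_pdivrMr//.
apply: lt_trans (uP m) _; rewrite ltr_pM2r//.
near: m; exact: near_infty_natSinv_lt (PosNum re0).
Unshelve. all: by end_near. Qed.

Lemma normc_le (a b : R) : normc (a +i* b) <= `|a| + `|b|.
Proof.
rewrite /= -[leRHS]ger0_norm ?addr_ge0// -sqrtr_sqr ler_wsqrtr//.
rewrite sqrrD !real_normK ?num_real// addrAC lerDl mulrn_wge0// mulr_ge0//.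
Qed.

(** Compactness of $[0, 2\pi]$ in near-covering form: around each [t0] either closeness to $1$
    persists, or the lower bound [d0] at [t0] survives with half its constant. *)
Lemma uniformly_bounded_below (T : {linear X -> X}) (e : R) :
    (forall l, unit_circle R l -> l != 1 -> ~ ap_spectrum T l) -> 0 < e ->
  exists2 d : R, 0 < d & forall t, 0 <= t <= pi *+ 2 -> normc (expi t - 1) <= e \/
      forall y, d * rnorm y <= rnorm (T y - expi t *: y).
Proof.
move=> Tsp e0.
have expi_near (t0 c : R) : 0 < c -> \forall t \near t0, normc (expi t - expi t0) < c.
  move=> c0.
  have c2 : 0 < c / 2 by rewrite divr_gt0.
  have hc := @cvgr_dist_lt _ _ _ _ _ _ _ (@continuous_cos R t0) _ c2.
  have hs := @cvgr_dist_lt _ _ _ _ _ _ _ (@continuous_sin R t0) _ c2.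
  near=> t.
  apply: le_lt_trans (normc_le _ _) _; rewrite [ltRHS]splitr ltrD//.
    by rewrite distrC; near: t; exact: hc.
  by rewrite distrC; near: t; exact: hs.
have nearT : \forall d \near (0 : R)^'+, `[0, pi *+ 2] `<=` (fun t =>
    normc (expi t - 1) <= e \/ forall y, d * rnorm y <= rnorm (T y - expi t *: y)).
  apply: (iffLR (compact_near_coveringP _) (@segment_compact R 0 (pi *+ 2))) => t0 _.
  have [lt_e|ge_e] := ltP (normc (expi t0 - 1)) e.
    have h : 0 < e - normc (expi t0 - 1) by rewrite subr_gt0.
    near=> t d; left.
    have -> : expi t - 1 = (expi t - expi t0) + (expi t0 - 1) by ring.
    apply: le_trans (le_normcD _ _) _; rewrite -lerBrDr ltW//.
    by near: t; exact: expi_near.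
  have t01 : expi t0 != 1.
    by apply: contraTneq ge_e => ->; rewrite subrr normc0 -ltNge.
  have [d0 d00 hd] := not_ap_spectrum_bounded_below (Tsp _ (normr_expi t0) t01).
  have d2 : 0 < d0 / 2 by rewrite divr_gt0.
  near=> t d; right => y.
  have -> : T y - expi t *: y = (T y - expi t0 *: y) - (expi t - expi t0) *: y.
    by rewrite scalerBl opprB addrA subrK.
  have h1 := hd y.
  have h2 := ler_rnormD (T y - expi t0 *: y - (expi t - expi t0) *: y) ((expi t - expi t0) *: y).
  rewrite subrK rnormZ in h2.
  have h3 : normc (expi t - expi t0) < d0 / 2 by near: t; exact: expi_near.
  have h4 : d < d0 / 2 by near: d; exact: nbhs_right_lt.
  have y0 := rnorm_ge0 y.
  have h5 := ler_wpM2r y0 (ltW h3); have h6 := ler_wpM2r y0 (ltW h4).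
  by rewrite /=; lra.
have [d [d0 hd]] := filter_ex (filterI (nbhs_right_gt (0 : R)) nearT).
by exists d => // t t2; apply: hd; rewrite /= in_itv.
Unshelve. all: by end_near. Qed.

End ApproximateSpectrum.

(** * Returns of a controlled orbit to a ball *)

Section Returns.
Context {R : realType} {X : normedModType R[i]}.

Lemma rnorm_iter_le (T : {linear X -> X}) (t : R) n x :
  0 <= t -> (forall u, rnorm (T u) <= t * rnorm u) ->
  rnorm (iter n T x) <= t ^+ n * rnorm x.
Proof.
move=> t0 Tt; elim: n => [|n ih]; first by rewrite expr0 mul1r.
rewrite iterS exprS -mulrA; apply: le_trans (Tt _) _.
by rewrite ler_wpM2l.
Qed.

(** Every time is fewer than [g] steps after a checkpoint, and each step costs a factor of at most
    [2 ^+ e]. *)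
Lemma orbit_bound_checkpoints (T : {linear X -> X}) (t B : R) (e g L : nat) x :
    0 <= t -> t <= 2 ^+ e -> 0 <= B -> (0 < g)%N ->
    (forall u, rnorm (T u) <= t * rnorm u) ->
    (forall i, (i * g <= L)%N -> rnorm (iter (g * i) T x) <= B) ->
  orbit_bound T L (2 ^+ (e * g) * B) x.
Proof.
move=> t0 te B0 g0 Tt xB n nL; rewrite (divn_eq n g) addnC iterD.
apply: le_trans (rnorm_iter_le _ _ t0 Tt) _.
rewrite ler_pM ?exprn_ge0 ?rnorm_ge0//; last first.
  by rewrite mulnC; apply: xB; apply: leq_trans nL; exact: leq_trunc_div.
apply: (@le_trans _ _ ((2 ^+ e) ^+ (n %% g))).
  by rewrite lerXn2r ?nnegrE ?exprn_ge0.
rewrite -exprM; apply: ler_weXn2l; first by rewrite ler1n.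
by rewrite leq_mul2l (ltnW (ltn_pmod _ g0)) orbT.
Qed.

(** Here $N = qeh$ and the degree threshold is $eh = N/q$. Checkpoints [q * h] apart cost a factor
    $2^{eqh} = 2^N$, and their number is independent of [h], so [B] can be fixed before [h]. *)
Lemma returns_lt (T : {linear X -> X}) (t d0 r B : R) (q m e h : nat) (p x : X) :
    0 <= t -> t <= 2 ^+ e -> (forall u, rnorm (T u) <= t * rnorm u) ->
    0 <= B -> 0 <= r -> (1 + t) * r <= rnorm (T p - p) / 4 ->
    0 < d0 -> 4 <= d0 * m%:R -> (0 < q)%N -> (0 < e)%N -> (0 < h)%N ->
    (forall a, 0 <= a <= pi *+ 2 -> normc (expi a - 1) <= 16^-1 ^+ q \/
      forall y, d0 * rnorm y <= rnorm (T y - expi a *: y)) ->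
    16 * (B * (5 * m + 2)%:R) < rnorm (T p - p) * 2 ^+ (q * e * h) ->
    (forall i, (i < e * (10 * m + 1) + 2)%N -> rnorm (iter (q * h * i) T x) <= B) ->
  (count (fun j => rnorm (iter j T (iter (5 * (q * e * h) * m) T x) - p) < r)%R
    (iota 0 (q * e * h)) < e * h)%N.
Proof.
move=> t0 te Tt B0 r0 tr d00 dm q0 e0 h0 Hd big xB.
set D0 := rnorm (T p - p) in tr big; set N := (q * e * h)%N in big *.
set M := (5 * N * m)%N.
have m0 : (0 < m)%N.
  by case: m dm {Hd big xB M} => // ; rewrite mulr0 => h4; lra.
have g0 : (0 < q * h)%N by rewrite muln_gt0 q0.
have N0 : (0 < N)%N by rewrite /N !muln_gt0 q0 e0.
pose W := (M + N).+1.
pose A : R := 2 ^+ N * B.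
have A0 : 0 <= A by rewrite mulr_ge0 ?exprn_ge0.
have xA : orbit_bound T (5 * N * m + W) A x.
  have -> : A = 2 ^+ (e * (q * h)) * B by rewrite /A /N; congr (2 ^+ _ * _); ring.
  apply: orbit_bound_checkpoints Tt _ => // i ig; apply: xB.
  (* The horizon is $N(10m+1) + 1$; one extra gap pays for the final $1$. *)
  have g1 : ((q * h) * (e * (10 * m + 1) + 1) >= 5 * N * m + W)%N.
    have -> : (q * h * (e * (10 * m + 1) + 1) = N * (10 * m + 1) + q * h)%N.
      by rewrite /N; ring.
    rewrite /W /M addnS -addn1 (_ : 5 * N * m + _ = N * (10 * m + 1))%N; last by ring.
    by rewrite leq_add2l.
  have : (i * (q * h) <= (e * (10 * m + 1) + 1) * (q * h))%N.
    by apply: leq_trans ig _; rewrite [leqRHS]mulnC.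
  by rewrite leq_pmul2r// => /leq_ltn_trans; apply; rewrite -addnS.
pose err : R := W%:R * A * (2 * 16^-1 ^+ N).
have err0 : 0 <= err by rewrite !mulr_ge0 ?exprn_ge0.
have small k : (e * h <= k <= N)%N ->
    rnorm (pact T (('X - 1) ^+ k) (iter M T x)) <= err.
  move=> /andP[dk kN].
  have e16 : (0 : R) <= 16^-1 ^+ q by rewrite exprn_ge0.
  apply: le_trans (localization d00 m0 A0 e16 xA Hd _ _) _ => //.
    by rewrite ltnS leq_add2l.
  rewrite ler_wpM2l ?mulr_ge0// [leRHS]mulr_natl [leRHS]mulr2n; apply: lerD.
    rewrite -exprM; apply: ler_wiXn2l; rewrite ?invr_ge0 ?invf_le1 ?ler1n//.
    by rewrite /N -mulnA leq_mul2l dk orbT.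
  (* Away from $1$ the ratio $2/(d_0 m)$ is at most $1/2$; the exponent $s = 5N$ is chosen so that
     $2^N 2^{-5N} = 16^{-N}$. *)
  apply: (@le_trans _ _ (2 ^+ N * 2^-1 ^+ (5 * N))).
    rewrite ler_pM ?exprn_ge0 ?divr_ge0 ?mulr_ge0 ?(ltW d00)//.
      by apply: ler_weXn2l; rewrite ?ler1n.
    have dm0 : 0 < d0 * m%:R by rewrite mulr_gt0 ?ltr0n.
    rewrite lerXn2r ?nnegrE ?divr_ge0 ?(ltW dm0)// ler_pdivrMr//.
    by move: dm; lra.
  rewrite exprM -exprMn le_eqVlt; apply/orP; left; apply/eqP; congr (_ ^+ _).
  by field.
rewrite ltnNge; apply/negP => visits.
have d_gt0 : (0 < e * h)%N by rewrite muln_gt0 e0.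
have := displacement_le_of_visits t0 r0 err0 Tt d_gt0 small visits; rewrite -/D0.
(* Both terms of the displacement bound are then at most a quarter of [D0]. *)
suff : 4 * (2 * (2 ^+ N * err)) < D0.
  have := rnorm_ge0 (T p - p); rewrite -/D0; lra.
have WN : W%:R <= (5 * m + 2)%:R * 2 ^+ N :> R.
  apply: (@le_trans _ _ ((5 * m + 2)%:R * N%:R)).
    by rewrite -natrM ler_nat /W /M -addnS mulnDl mulnAC leq_add2l mul2n -addnn -addn1 leq_add2l.
  by rewrite ler_wpM2l// -natrX ler_nat ltnW// ltn_expl.
(* Checkpoints and Newton series each cost $2^N$, leaving $4^{-N}$ of $16^{-N}$; [WN] spends one
   more $2^N$. *)
have -> : 4 * (2 * (2 ^+ N * err)) = 16 * (B * W%:R) * (4^-1 ^+ N).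
  rewrite /err /A.
  have -> : (4^-1 : R) = 2 * 2 * 16^-1 by field.
  by rewrite !exprMn; ring.
apply: (@le_lt_trans _ _ (16 * (B * ((5 * m + 2)%:R * 2 ^+ N)) * 4^-1 ^+ N)).
  by rewrite ler_wpM2r ?exprn_ge0// ler_wpM2l// ler_wpM2l.
have -> : 16 * (B * ((5 * m + 2)%:R * 2 ^+ N)) * 4^-1 ^+ N
    = 16 * (B * (5 * m + 2)%:R) / 2 ^+ N :> R.
  rewrite -exprVn.
  have -> : (2^-1 : R) = 2 * 4^-1 by field.
  by rewrite exprMn; ring.
by rewrite ltr_pdivrMr ?exprn_gt0.
Qed.

End Returns.

(** * Borel measures and counting *)

Section Borel.
Context {R : realType} {X : normedModType R[i]}.

Lemma open_rnormP (A : set X) : open A <->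
  forall x, A x -> exists2 r : R, 0 < r & forall y, rnorm (y - x) < r -> A y.
Proof.
rewrite openE; split=> [Ao x /Ao|Ao x /Ao[r r0 rA]].
  move=> /nbhs_ballP[e /= e0 eA]; have eE : e = (complex.Re e)%:C.
    by rewrite RRe_real// gtr0_real.
  exists (complex.Re e); first by rewrite -ltcR -eE.
  by move=> y yx; apply: eA; rewrite -ball_normE /= distrC eE normE ltcR.
apply/nbhs_ballP; exists r%:C; first by rewrite /= ltcR.
by move=> y; rewrite -ball_normE /= distrC normE ltcR => /rA.
Qed.

Lemma open_borel (A : set X) : open A -> measurable (A : set (borel X)).
Proof. by move=> Ao; apply: sub_sigma_algebra. Qed.

Lemma open_near (p : X) (r : R) : open [set x : X | rnorm (x - p) < r].
Proof.
apply/open_rnormP => x /= xp; exists (r - rnorm (x - p)); first by rewrite subr_gt0.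
move=> y; rewrite ltrBrDr; apply: le_lt_trans.
by apply: le_trans (ler_rnormD _ _); rewrite addrA subrK.
Qed.

Lemma open_rnorm_gt (B : R) : open [set x : X | B < rnorm x].
Proof.
apply/open_rnormP => x /= xB; exists (rnorm x - B); first by rewrite subr_gt0.
move=> y yx; have := ler_rnormD (x - y) y; rewrite subrK rnormB; lra.
Qed.

Lemma open_preimage (T : {linear X -> X}) (t : R) (A : set X) :
  0 <= t -> (forall u, rnorm (T u) <= t * rnorm u) -> open A -> open (T @^-1` A).
Proof.
move=> t0 Tt /open_rnormP Ao; apply/open_rnormP => x /= /Ao[r r0 rA].
exists (r / (t + 1)); first by rewrite divr_gt0// ltr_wpDl.
move=> y yx; apply: rA; rewrite -(linearB T); apply: le_lt_trans (Tt _) _.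
have := yx; rewrite ltr_pdivlMr ?ltr_wpDl// => h.
by have := rnorm_ge0 (y - x); nra.
Qed.

Lemma open_iter_preimage (T : {linear X -> X}) (t : R) n (A : set X) :
    0 <= t -> (forall u, rnorm (T u) <= t * rnorm u) -> open A ->
  open (iter n T @^-1` A).
Proof.
move=> t0 Tt; elim: n A => [//|n ih] A Ao.
exact: (ih (T @^-1` A) (open_preimage t0 Tt Ao)).
Qed.

Lemma invariant_iter (T : {linear X -> X}) (t : R) (rho : probability (borel X) R)
    n (A : set X) :
    0 <= t -> (forall u, rnorm (T u) <= t * rnorm u) ->
    invariant_measure T rho -> open A ->
  rho (iter n T @^-1` A) = rho A.
Proof.
move=> t0 Tt Trho; elim: n A => [//|n ih] A Ao.
rewrite -[LHS]/(rho (iter n T @^-1` (T @^-1` A))) ih; last exact: open_preimage t0 Tt Ao.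
by apply: Trho; exact: open_borel.
Qed.

(** Continuity from above along $\{|x| > n\}$, which decreases to the empty set. *)
Lemma tail_small (rho : probability (borel X) R) (e : R) : 0 < e ->
  exists2 B : R, 0 <= B & (rho [set x : borel X | (B < rnorm (x : X))%R] < e%:E)%E.
Proof.
move=> e0; pose F (n : nat) : set (borel X) := [set x | n%:R < rnorm (x : X)].
have mF n : measurable (F n) by apply: open_borel; exact: open_rnorm_gt.
have F0 : \bigcap_n F n = set0.
  apply/seteqP; split=> // x /= xF.
  have := xF (Num.truncn (rnorm (x : X))).+1 Logic.I; rewrite /F /=.
  by rewrite ltNge ltW// truncnS_gt.
have cvgF : rho (F n) @[n --> \oo] --> (0 : \bar R).
  rewrite -(measure0 rho) -F0; apply: nonincreasing_cvg_mu => //.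
  - by apply: le_lt_trans (probability_le1 _ (mF _)) _; rewrite ltry.
  - by rewrite F0; exact: measurable0.
  - move=> n m nm; apply/subsetPset => x; rewrite /F /=; apply: le_lt_trans.
    by rewrite ler_nat.
apply: contrapT => h.
suff : (e%:E <= 0)%E by rewrite lee_fin leNgt e0.
apply: (cvge_to_ge cvgF); apply: nearW => n; rewrite leNgt; apply/negP => Fn.
by apply: h; exists n%:R.
Qed.

(* A separable space is Lindelof, so the points all of whose balls have
   positive measure carry the whole measure. *)
Lemma open_positive_point (sepX : separable X) (rho : probability (borel X) R)
    (U : set X) : open U -> rho U != 0%E ->
  exists2 p : X, U p & forall r : R, 0 < r ->
    rho [set x : borel X | rnorm ((x : X) - p) < r] != 0%E.
Proof.
move=> Uo; apply: contraNP => h.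
have mball (p : X) (r : R) : measurable [set x : borel X | rnorm ((x : X) - p) < r].
  by apply: open_borel; exact: open_near.
case: sepX => D /countable_injP[f finj] Ddense.
(* The ball of radius $1/(m+1)$ about the point of [D] with index [n] if that ball is null, and
   empty otherwise. *)
pose B (n m : nat) : set (borel X) := [set x : borel X | exists q : X,
  [/\ D q, f q = n, rho [set x : borel X | rnorm ((x : X) - q) < m.+1%:R^-1] = 0%E
    & rnorm ((x : X) - q) < m.+1%:R^-1]].
apply/eqP/(negligibleP _ (open_borel Uo)).
apply: (@negligibleS _ _ _ _ (\bigcup_n \bigcup_m B n m)); last first.
  apply: negligible_bigcup => n; apply: negligible_bigcup => m.
  have [[q [Dq fq q0]]|nq] := pselect (exists q, [/\ D q, f q = n &
      rho [set x : borel X | rnorm ((x : X) - q) < m.+1%:R^-1] = 0%E]).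
    exists [set x : borel X | rnorm ((x : X) - q) < m.+1%:R^-1]; split => //.
    move=> x [q' [Dq' fq' _ xq']].
    by rewrite (finj q q') ?inE// fq.
  exists set0; split => //.
  by move=> x [q [Dq fq q0 _]]; apply: nq; exists q.
move=> p Up.
have [r r0 pr] : exists2 r : R, 0 < r &
    rho [set x : borel X | rnorm ((x : X) - p) < r] = 0%E.
  apply: contrapT => hr; apply: h; exists p => // r r0; apply/eqP => pr.
  by apply: hr; exists r.
(* A ball of radius $1/(m+1)$ about a point of [D] that close to [p] lies in the null ball about
   [p]. *)
pose m := Num.truncn (2 / r).
have mr : 2 * m.+1%:R^-1 < r.
  by rewrite ltr_pdivrMr// mulrC -ltr_pdivrMr// truncnS_gt.
have m0 : 0 < m.+1%:R^-1 :> R by rewrite invr_gt0.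
have ne : [set x : X | rnorm (x - p) < m.+1%:R^-1] !=set0.
  by exists p => /=; rewrite subrr rnorm0.
have [q [/= qp Dq]] := Ddense _ ne (open_near _ _).
exists (f q) => //; exists m => //.
suff q0 : rho [set x : borel X | rnorm ((x : X) - q) < m.+1%:R^-1] = 0%E.
  by exists q; split; rewrite // rnormB.
apply/eqP; rewrite eq_le measure_ge0 andbT -pr.
apply: le_measure; rewrite ?inE// => x /= xq; apply: le_lt_trans mr.
have := ler_rnormD ((x : X) - q) (q - p); rewrite addrA subrK => /le_trans; apply.
by rewrite mulr_natl mulr2n lerD// ltW.
Qed.

End Borel.

Section Counting.
Context (d : measure_display) (Omega : measurableType d) (R : realType).

(** Integrate the pointwise inequality. [A j] will be a visit at time [j], and [F i] a failure at
    checkpoint [i]. *)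
Lemma count_measure_le (P : probability Omega R) (A F : nat -> set Omega)
    (a f : R) (N L k : nat) :
    (forall j, measurable (A j)) -> (forall i, measurable (F i)) ->
    (forall j, P (A j) = a%:E) -> (forall i, P (F i) = f%:E) ->
    (forall x, \sum_(j < N) \1_(A j) x <= k%:R + N%:R * \sum_(i < L) \1_(F i) x :> R) ->
  N%:R * a <= k%:R + N%:R * (L%:R * f).
Proof.
move=> mA mF PA PF AF.
have m1 (B : set Omega) : measurable B ->
    measurable_fun setT (EFin \o (\1_B : Omega -> R)).
  by move=> mB; apply/measurable_EFinP; exact: measurable_indic.
have f1 (B : set Omega) x : (0 <= (\1_B x : R)%:E)%E by rewrite lee_fin.
have sumE (B : nat -> set Omega) b n : (forall j, measurable (B j)) ->
    (forall j, P (B j) = b%:E) ->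
    (\int[P]_x (\sum_(j < n) (\1_(B j) x : R)%:E) = (n%:R * b)%:E)%E.
  move=> mB PB; rewrite ge0_integral_sum//; last by move=> j; apply: m1.
  rewrite (eq_bigr (fun=> b%:E)); last first.
    by move=> j _; rewrite integral_indic// setIT; exact: PB.
  by rewrite sumEFin sumr_const card_ord mulr_natl.
have mS (B : nat -> set Omega) n : (forall j, measurable (B j)) ->
    measurable_fun setT ((fun x => \sum_(j < n) (\1_(B j) x : R)%:E)%E : Omega -> \bar R).
  by move=> mB; apply: emeasurable_sum => j; apply: m1.
have S0 (B : nat -> set Omega) n x : (0 <= \sum_(j < n) (\1_(B j) x : R)%:E)%E.
  by apply: sume_ge0 => j _.
rewrite -lee_fin -(sumE A a)//.
apply: (@le_trans _ _ (\int[P]_x (k%:R%:E + N%:R%:E * \sum_(i < L) (\1_(F i) x : R)%:E))%E).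
  apply: ge0_le_integral => //.
  - exact: mS.
  - apply: emeasurable_funD => //; apply: emeasurable_funM => //; exact: mS.
  - by move=> x _; rewrite !sumEFin -EFinM -EFinD lee_fin; exact: AF.
rewrite ge0_integralD//; last 2 first.
- by move=> x _; rewrite mule_ge0.
- by apply: emeasurable_funM => //; exact: mS.
have -> : (\int[P]_x k%:R%:E = (k%:R : R)%:E)%E.
  rewrite integral_cst//; transitivity ((k%:R : R)%:E * 1)%E; last by rewrite mule1.
  by congr (_ * _)%E; exact: probability_setT.
rewrite ge0_integralZl//; last exact: mS.
by rewrite (sumE F f)// -EFinM -EFinD.
Qed.

End Counting.

(** * Non-fixing measures *)

Section NonFixing.
Context {R : realType} {X : normedModType R[i]}.

Lemma sum_indic_count (A : nat -> set X) (a : nat -> bool) (N : nat) (x : X) :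
    (forall j, a j <-> A j x) ->
  \sum_(j < N) \1_(A j) x = (count a (iota 0 N))%:R :> R.
Proof.
move=> aA; rewrite -sum1_count natr_sum [RHS]big_mkcond /=.
rewrite -(big_mkord xpredT (fun j => \1_(A j) x : R)) /index_iota subn0.
apply: eq_bigr => j _; rewrite indicE; case: ifPn => [/aA Aj|naj].
  by rewrite mem_set.
by rewrite memNset// => /aA; apply/negP.
Qed.

(** If $Ty = y$ then $Tx - x = (y-x) - T(y-x)$, so fixed points stay at distance at least
    $|Tx-x|/(1+t)$ from [x]. *)
Lemma open_nonfixed (T : {linear X -> X}) (t : R) :
    0 <= t -> (forall u, rnorm (T u) <= t * rnorm u) -> open [set x | T x <> x].
Proof.
move=> t0 Tt; apply/open_rnormP => x /= Tx.
have Dx : 0 < rnorm (T x - x) by rewrite rnorm_gt0 subr_eq0; apply/eqP.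
have t1 : 0 < t + 1 by rewrite ltr_wpDl.
exists (rnorm (T x - x) / (t + 1)); first by rewrite divr_gt0.
move=> y; rewrite ltr_pdivlMr// => yx Ty; move: yx; apply/negP; rewrite -leNgt.
have -> : T x - x = (y - x) - T (y - x).
  by rewrite linearB Ty opprB [RHS]addrC addrA subrK.
by apply: le_trans (ler_rnormB _ _) _; have := Tt (y - x); lra.
Qed.

Lemma nonfixing_spectrum (sepX : separable X) (T : {linear X -> X}) (t : R)
    (rho : probability (borel X) R) :
    0 <= t -> (forall u, rnorm (T u) <= t * rnorm u) ->
    invariant_measure T rho -> rho [set x : borel X | T x <> x :> X] != 0%E ->
  ap_spectrum T `&` (unit_circle R `\ 1) !=set0.
Proof.
move=> t0 Tt Trho U0; apply: contrapT => nsp.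
have Tsp l : unit_circle R l -> l != 1 -> ~ ap_spectrum T l.
  by move=> l1 ln1 Tl; apply: nsp; exists l; split => //; split => //; apply/eqP.
have [p Up pball] := open_positive_point sepX (open_nonfixed t0 Tt) U0.
have Dp : 0 < rnorm (T p - p) by rewrite rnorm_gt0 subr_eq0; apply/eqP.
pose r := rnorm (T p - p) / 4 / (1 + t).
have t1 : 0 < 1 + t by rewrite ltr_pwDl.
have r0 : 0 < r by rewrite !divr_gt0.
have rE : (1 + t) * r <= rnorm (T p - p) / 4 by rewrite mulrC divfK ?gt_eqF.
pose C := [set x : X | rnorm (x - p) < r].
have Co : open C by exact: open_near.
have fin (A : set (borel X)) : measurable A -> rho A = (fine (rho A))%:E.
  by move=> mA; rewrite fineK// fin_num_measure.
pose c := fine (rho C).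
have cE : rho C = c%:E by apply: fin; exact: open_borel.
have c0 : 0 < c.
  by rewrite lt_neqAle fine_ge0 ?measure_ge0// andbT -eqe -cE eq_sym pball.
(* Makes the expected number [N c] of visits exceed twice the allowed $eh = N/q$. Then [d], [m],
   [L], [B] and finally [h] are chosen, each from earlier data. *)
pose q := (Num.truncn (2 / c)).+1.
have qc : 2 < q%:R * c by rewrite -ltr_pdivrMr// truncnS_gt.
pose eps : R := 16^-1 ^+ q.
have eps0 : 0 < eps by rewrite exprn_gt0// invr_gt0.
have [d d0 Hd] := uniformly_bounded_below Tsp eps0.
pose m := (Num.truncn (4 / d)).+1.
have dm : 4 <= d * m%:R by rewrite mulrC -ler_pdivrMr// ltW// truncnS_gt.
pose e := (Num.truncn t).+1.
have te : t <= 2 ^+ e.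
  apply: le_trans (ltW (truncnS_gt t)) _.
  by rewrite -natrX ler_nat ltnW// ltn_expl.
pose L := (e * (10 * m + 1) + 2)%N.
have L0 : 0 < L%:R :> R by rewrite ltr0n /L addn2.
(* With this tail mass, the [L] checkpoints together fail with probability at most $c/4$. *)
have cL : 0 < c / (4 * L%:R) by rewrite divr_gt0// mulr_gt0.
have [B B0 rhoB] := tail_small rho cL.
pose F := [set x : X | B < rnorm x].
have Fo : open F by exact: open_rnorm_gt.
pose f := fine (rho F).
have fE : rho F = f%:E by apply: fin; exact: open_borel.
have fc : L%:R * f <= c / 4.
  have : f < c / (4 * L%:R) by rewrite -lte_fin -fE.
  rewrite ltr_pdivlMr ?mulr_gt0//; lra.
pose h := (Num.truncn (16 * (B * (5 * m + 2)%:R) / rnorm (T p - p))).+1.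
pose N := (q * e * h)%N.
have hbig : 16 * (B * (5 * m + 2)%:R) < rnorm (T p - p) * 2 ^+ N.
  rewrite [ltRHS]mulrC -ltr_pdivrMr//; apply: lt_le_trans (truncnS_gt _) _.
  have hN : (h <= N)%N by rewrite /N leq_pmull.
  by rewrite -natrX ler_nat; apply: leq_trans hN _; rewrite ltnW// ltn_expl.
have mpre n (A : set X) : open A -> measurable (iter n T @^-1` A : set (borel X)).
  by move=> Ao; apply: open_borel; exact: open_iter_preimage t0 Tt Ao.
have main : N%:R * c <= (e * h)%:R + N%:R * (L%:R * f).
  apply: (@count_measure_le _ _ R rho
    (fun j => iter (j + 5 * N * m) T @^-1` C) (fun i => iter (q * h * i) T @^-1` F)).
  - by move=> j; exact: mpre.
  - by move=> i; exact: mpre.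
  - by move=> j; rewrite -cE; exact: invariant_iter t0 Tt Trho Co.
  - by move=> j; rewrite -fE; exact: invariant_iter t0 Tt Trho Fo.
  move=> x.
  (* After a failed checkpoint the trivial bound [N] is paid by the sum over [F]; otherwise
     [returns_lt] allows fewer than [e * h] visits. *)
  have [xF|nxF] := pselect (exists2 i, (i < L)%N & F (iter (q * h * i) T x)).
    case: xF => i iL xF.
    apply: ler_wpDl => //; apply: (@le_trans _ _ (N%:R * 1)).
      rewrite mulr1 -[N in leRHS]card_ord -sumr_const; apply: ler_sum => j _.
      by rewrite indicE lern1 leq_b1.
    rewrite ler_wpM2l// (bigD1 (Ordinal iL))//=; apply: ler_wpDr.
      by apply: sumr_ge0 => k _.
    by rewrite indicE mem_set.
  apply: ler_wpDr; first by rewrite mulr_ge0//; apply: sumr_ge0 => k _.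
  rewrite (sum_indic_count (A := fun j => iter (j + 5 * N * m) T @^-1` C)
     (a := fun j => rnorm (iter j T (iter (5 * N * m) T x) - p) < r)).
    rewrite ler_nat ltnW//; apply: (returns_lt t0 te Tt B0 (ltW r0) rE d0 dm _ _ _ Hd hbig) => //.
    by move=> i iL; rewrite leNgt; apply/negP => xB; apply: nxF; exists i.
  by move=> j; rewrite /C /= iterD.
have eh0 : 0 < (e * h)%:R :> R by rewrite ltr0n muln_gt0.
have NE : N%:R = q%:R * (e * h)%:R :> R by rewrite -natrM mulnA.
(* Thus $Nc \le eh + Nc/4$, while $eh < Nc/2$: a contradiction. *)
have : N%:R * (L%:R * f) <= N%:R * (c / 4) by rewrite ler_wpM2l.
have : 2 * (e * h)%:R < N%:R * c by rewrite NE mulrAC ltr_pM2r.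
by move: main eh0; clear; lra.
Qed.

End NonFixing.

(** * The two assertions *)

Theorem theorem1p5 (R : realType) (X : completeNormedModType R[i])
    (sepX : separable X)
    (T : {linear X -> X}) (bddT : bounded_operator T)
    (rho : probability (borel X) R)
    (rho_inv : invariant_measure T rho)
    (rho_nontriv : ~ eq_borel_measure rho (dirac ((0 : X) : borel X))) :
  ap_spectrum T `&` unit_circle R !=set0 /\
  ((rho [set x : borel X | T x = x :> X] < 1)%E ->
     ap_spectrum T `&` (unit_circle R `\ 1) !=set0).
Proof.
have [M MT] := bddT; pose t := `|M|.
have Tt u : rnorm (T u) <= t * rnorm u.
  rewrite -lecR rmorphM/= -!normE; apply: le_trans (MT u) _.
  by rewrite ler_wpM2r// lecR ler_norm.
have t0 : 0 <= t := normr_ge0 M.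
set Fix := [set x : borel X | T x = x :> X].
have FixC : Fix = ~` [set x : borel X | T x <> x :> X].
  by apply/seteqP; split => x /=; [move=> h; exact | exact: contrapT].
have mU : measurable [set x : borel X | T x <> x :> X].
  by apply: open_borel; exact: open_nonfixed t0 Tt.
have rhoFix : rho Fix = (1 - rho [set x : borel X | T x <> x :> X])%E.
  by rewrite FixC probability_setC.
have part2 : (rho Fix < 1)%E -> ap_spectrum T `&` (unit_circle R `\ 1) !=set0.
  move=> Fix1; apply: (nonfixing_spectrum sepX t0 Tt rho_inv).
  by apply: contraTneq Fix1 => U0; rewrite rhoFix U0 sube0 ltxx.
split=> //.
have [/part2[l [Tl [l1 _]]]|Fix1] := ltP (rho Fix) 1%E; first by exists l.
have mFix : measurable Fix by rewrite FixC; exact: measurableC.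
(* Otherwise a measure carried by the fixed points lives on $\{0\}$ and agrees with the Dirac mass
   on Borel sets. *)
have [x [Tx x0]] : exists x : X, T x = x /\ x != 0.
  apply: contrapT => nx; apply: rho_nontriv.
  have Fix0 : Fix `<=` [set (0 : X)].
    move=> x Tx; apply: contrapT => x0; apply: nx; exists x; split=> //.
    exact/eqP.
  have Fix1' : rho Fix = 1%E.
    by apply/eqP; rewrite eq_le Fix1 andbT probability_le1.
  have FixC0 : rho (~` Fix) = 0%E by rewrite probability_setC// Fix1' subee.
  move=> B mB; rewrite [RHS](_ : _ = (((0 : X) \in B)%:R)%:E); last exact: diracE.
  case: (pselect (B (0 : X))) => B0.
    rewrite mem_set//; apply/eqP; rewrite eq_le probability_le1//=.
    rewrite -Fix1'; apply: le_measure; rewrite ?inE// => x /Fix0 ->.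
    exact: B0.
  rewrite memNset//; apply: le_anti; rewrite measure_ge0 andbT.
  apply: (@le_trans _ _ (rho (~` Fix))); last by rewrite FixC0.
  apply: le_measure; [exact/mem_set | exact/mem_set/measurableC |].
  by move=> x Bx /Fix0 x0; apply: B0; rewrite -x0.
exists 1; split; last by rewrite /unit_circle /= normr1.
(* A normalized fixed vector, as a constant sequence. *)
exists (fun=> ((rnorm x)^-1)%:C *: x); split.
  move=> _; rewrite normE rnormZr ger0_norm ?invr_ge0 ?rnorm_ge0//.
  by rewrite mulVf// gt_eqF// rnorm_gt0.
rewrite linearZ /= Tx scale1r subrr normr0; exact: cvg_cst.
Qed.
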